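(* Let $(S,\circ)$ be a right loop with identity $1$. Assume that the stability relation $\sigma(S)$ is a congruence on $S$. Then: (A) if $\sigma(S)_1=Z(G_SS)$ and $(v\circ u)\circ w=v\circ(u\circ w)$ for all $u\in\sigma(S)_1$ and all $v,w\in S$, then $\sigma(S)_1=\mathcal{Z}(S)$; (B) if $\sigma(S)_1=\mathcal{Z}(S)$, then $\sigma(S)_1\subseteq Z(G_SS)$ and $N_{G_SS}(G_S)=G_S\,Z(G_SS)$. Here $Z(G_SS)$ denotes the center of the group $G_SS$ and $N_{G_SS}(G_S)$ the normalizer of $G_S$ in $G_SS$; elements $x\in S$ are identified with $R_x\in G_SS$.
   Context: A right loop $(S,\circ)$ is a set with a binary operation having a two-sided identity $1$ such that for all $a,b\in S$ the equation $X\circ a=b$ has a unique solution $X\in S$, denoted $b/a$. A right subloop is a nonempty subset which is a right loop under the induced operation. Direct products of right loops are right loops componentwise. For $x\in S$ let $R_x:S\to S$, $R_x(y)=y\circ x$ (a bijection). Products in $Sym(S)$ are written $(rs)(x)=s(r(x))$, so $Sym(S)$ acts on $S$ on the right. Let $G_S=\langle R_yR_zR_{y\circ z}^{-1}\mid y,z\in S\rangle$ (the group torsion of $S$) and $G_SS=\langle R_u\mid u\in S\rangle\le Sym(S)$. Then $G_S$ is the stabilizer of $1$ in $G_SS$, and every element of $G_SS$ is uniquely of the form $hR_u$ with $h\in G_S$, $u\in S$. The set $S$ is identified with the subset $\{R_u\mid u\in S\}$ of $G_SS$ via $u\mapsto R_u$; equalities and inclusions between subsets of $S$ and subsets of $G_SS$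 are understood under this identification. The stability relation on $S$ is the equivalence relation $\sigma(S)=\{(x,y)\in S\times S\mid stab(G_SS,x)=stab(G_SS,y)\}$, where $stab(G_SS,x)$ is the stabilizer of $x$ in $G_SS$. For an equivalence relation $\delta$ on a set, $\delta_w$ denotes the equivalence class of $w$; so $\sigma(S)_1$ is the class of $1$. A congruence on a right loop is an equivalence relation compatible with both operations $\circ$ and $/$. A congruence $\beta$ on $S$ is a right subloop of $S\times S$, so one can speak of congruences on $\beta$. Let $\beta,\gamma$ be congruences on $S$. Then $\gamma$ centralizes $\beta$ by means of the centering congruence $(\gamma|\beta)$ if $(\gamma|\beta)$ is a congruence on $\beta$ such that: (i) $(x,y)\,(\gamma|\beta)\,(u,v)\Rightarrow x\,\gamma\,u$, for all $(x,y),(u,v)\in\beta$; (ii) for all $(x,y)\in\beta$, the map $(\gamma|\beta)_{(x,y)}\to\gamma_x$, $(u,v)\mapsto u$, is a bijection; (iii) for all $(x,y)\in\gamma$, $(x,x)\,(\gamma|\beta)\,(y,y)$; (iv) $(x,y)\,(\gamma|\beta)\,(u,v)\Rightarrow(y,x)\,(\gamma|\beta)\,(v,u)$, for all $(x,y),(u,v)\in\beta$; (v) $(x,y)\,(\gamma|\beta)\,(u,v)$ and $(y,z)\,(\gamma|\beta)\,(v,w)$ imply $(x,z)\,(\gamma|\beta)\,(u,w)$, for all $(x,y),(u,v),(y,z),(v,w)\in\beta$. A congruence on $S$ is central if it is centralized by $S\times S$ (by means of some centering congruence). There is a unique maximal central congruence $\zeta(S)$ on $S$, called the center congruence; the center of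 $S$ is $\mathcal{Z}(S)=\zeta(S)_1$, the equivalence class of $1$. *)

(* Defs.v *)
From HB Require Import structures.
From mathcomp Require Import all_boot.
From mathcomp Require Import boolp classical_sets functions.

Set Implicit Arguments.
Unset Strict Implicit.
Unset Printing Implicit Defensive.

Local Open Scope classical_set_scope.

Declare Scope rloop_scope.
Delimit Scope rloop_scope with L.

HB.mixin Record isRightLoop S := {
  rlone : S;
  rlmul : S -> S -> S;
  rldiv : S -> S -> S;
  rlmul1l : left_id rlone rlmul;
  rlmul1r : right_id rlone rlmul;
  rldivP : forall a b x : S, rlmul x a = b <-> x = rldiv b a
}.

#[short(type="rightLoopType")]
HB.structure Definition RightLoop := {S of isRightLoop S}.

Bind Scope rloop_scope with RightLoop.sort.
Arguments rlone {s}.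

Notation "1" := (@rlone _) : rloop_scope.
Notation "x ∘ y" := (rlmul x y)
  (at level 40, left associativity) : rloop_scope.
Notation "x / y" := (rldiv x y) : rloop_scope.

Lemma rldivK (S : rightLoopType) (a b : S) : ((b / a) ∘ a = b)%L.
Proof. exact/rldivP. Qed.

Lemma rlmulK (S : rightLoopType) (a x : S) : ((x ∘ a) / a = x)%L.
Proof. by apply/esym/rldivP. Qed.

Section ProdRightLoop.
Variables S T : rightLoopType.
Local Open Scope rloop_scope.

Definition prod_rlmul (p q : S * T) : S * T := (p.1 ∘ q.1, p.2 ∘ q.2).
Definition prod_rldiv (p q : S * T) : S * T := (p.1 / q.1, p.2 / q.2).

Fact prod_rlmul1l : left_id ((1, 1) : S * T) prod_rlmul.
Proof. by case=> x y; rewrite /prod_rlmul !rlmul1l. Qed.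

Fact prod_rlmul1r : right_id ((1, 1) : S * T) prod_rlmul.
Proof. by case=> x y; rewrite /prod_rlmul !rlmul1r. Qed.

Fact prod_rldivP (a b x : S * T) : prod_rlmul x a = b <-> x = prod_rldiv b a.
Proof.
case: a b x => [a a'] [b b'] [x x'].
by split=> [[/rldivP -> /rldivP ->]|[-> ->]]; rewrite // /prod_rlmul !rldivK.
Qed.

HB.instance Definition _ := isRightLoop.Build (S * T)%type
  prod_rlmul1l prod_rlmul1r prod_rldivP.
End ProdRightLoop.

Record sym (T : Type) := Sym {
  sym_fun :> T -> T;
  sym_inv : T -> T;
  symK : cancel sym_fun sym_inv;
  symVK : cancel sym_inv sym_fun
}.

Lemma symP (T : Type) (f g : sym T) : f =1 g -> f = g.
Proof.
case: f g => [f f' fK f'K] [g g' gK g'K] /= /funext efg; subst g.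
have e : f' = g' by apply: funext => x; rewrite -{1}(g'K x) fK.
by subst g'; congr Sym; apply: Prop_irrelevance.
Qed.

HB.instance Definition _ (T : Type) := gen_eqMixin (sym T).
HB.instance Definition _ (T : Type) := gen_choiceMixin (sym T).

Section SymGroup.
Variable T : Type.

(* Products are read from left to right: (r * s) x = s (r x). *)
Definition sym_mul (r s : sym T) : sym T :=
  Sym (can_comp (symK s) (symK r)) (can_comp (symVK r) (symVK s)).
Definition sym_one : sym T := @Sym T id id (frefl _) (frefl _).
Definition sym_invg (r : sym T) : sym T := Sym (symVK r) (symK r).

Fact sym_mulA : associative sym_mul.
Proof. by move=> r s t; apply: symP. Qed.
Fact sym_mul1 : left_id sym_one sym_mul.
Proof. by move=> r; apply: symP. Qed.
Fact sym_mulr1 : right_id sym_one sym_mul.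
Proof. by move=> r; apply: symP. Qed.
Fact sym_mulV : left_inverse sym_one sym_invg sym_mul.
Proof. by move=> r; apply: symP => x; apply: (symVK r). Qed.
Fact sym_mulrV : right_inverse sym_one sym_invg sym_mul.
Proof. by move=> r; apply: symP => x; apply: (symK r). Qed.

HB.instance Definition _ := isGroup.Build (sym T)
  sym_mulA sym_mul1 sym_mulr1 sym_mulV sym_mulrV.
End SymGroup.

Section GroupSubsets.
Variable G : groupType.
Local Open Scope group_scope.

Definition subgroup (H : set G) : Prop :=
  [/\ H 1, forall x y, H x -> H y -> H (x * y) & forall x, H x -> H x^-1].

Definition generated (A : set G) : set G := smallest subgroup A.

Definition centerg (H : set G) : set G :=
  [set z | H z /\ forall g, H g -> z * g = g * z].

(* For infinite K, inclusion of the conjugate in K would not be enough. *)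
Definition normalizer_in (H K : set G) : set G :=
  [set g | H g /\ [set k ^ g | k in K] = K].

Definition mul_set (A B : set G) : set G := [set a * b | a in A & b in B].
End GroupSubsets.

Section RightMultiplications.
Variable S : rightLoopType.

Fact rmulK_subproof (x : S) : cancel (rlmul^~ x) (rldiv^~ x).
Proof. by move=> y; apply: rlmulK. Qed.
Fact rmulVK_subproof (x : S) : cancel (rldiv^~ x) (rlmul^~ x).
Proof. by move=> y; apply: rldivK. Qed.

Definition rtrans (x : S) : sym S :=
  Sym (@rmulK_subproof x) (@rmulVK_subproof x).

Definition group_torsion : set (sym S) :=
  generated [set g | exists y z : S,
    g = (rtrans y * rtrans z * (rtrans (y ∘ z)%L)^-1)%g].

Definition rmul_group : set (sym S) := generated (range rtrans).
End RightMultiplications.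
Arguments rtrans S x : clear implicits.
Arguments group_torsion S : clear implicits.
Arguments rmul_group S : clear implicits.

Definition stab (T : Type) (G : set (sym T)) (x : T) : set (sym T) :=
  [set g | G g /\ g x = x].

Definition stability (S : rightLoopType) : set (S * S) :=
  [set p | stab (rmul_group S) p.1 = stab (rmul_group S) p.2].
Arguments stability S : clear implicits.

Definition eq_class (T : Type) (d : set (T * T)) (w : T) : set T :=
  [set x | d (w, x)].

(* d is a congruence on the right subloop B of L; the operations of B, and in
   particular its right division, are the restrictions of those of L. *)
Record congruence_on (L : rightLoopType) (B : set L) (d : set (L * L)) : Prop :=
  CongruenceOn {
    congr_sub : d `<=` B `*` B;
    congr_refl : forall x, B x -> d (x, x);
    congr_sym : forall x y, d (x, y) -> d (y, x);
    congr_trans : forall x y z, d (x, y) -> d (y, z) -> d (x, z);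
    congr_mul : forall x y u v, d (x, y) -> d (u, v) ->
      d (x ∘ u, y ∘ v)%L;
    congr_div : forall x y u v, d (x, y) -> d (u, v) ->
      d (x / u, y / v)%L
  }.

Definition congruence (S : rightLoopType) (d : set (S * S)) : Prop :=
  congruence_on setT d.

(* c is a centering congruence (g|b). The requirement that the pairs lie in b
   is part of c being a congruence on b. *)
Record centering (S : rightLoopType) (g b : set (S * S))
    (c : set ((S * S) * (S * S))) : Prop := Centering {
  centering_congr : congruence_on b c;
  centering_fst : forall x y u v, c ((x, y), (u, v)) -> g (x, u);
  centering_bij : forall x y, b (x, y) ->
    set_bij (eq_class c (x, y)) (eq_class g x) fst;
  centering_diag : forall x y, g (x, y) -> c ((x, x), (y, y));
  centering_sym : forall x y u v,
    c ((x, y), (u, v)) -> c ((y, x), (v, u));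
  centering_trans : forall x y z u v w,
    c ((x, y), (u, v)) -> c ((y, z), (v, w)) -> c ((x, z), (u, w))
}.

Definition centralizes (S : rightLoopType) (g b : set (S * S)) : Prop :=
  exists c, centering g b c.

Definition central (S : rightLoopType) (b : set (S * S)) : Prop :=
  congruence b /\ centralizes setT b.

Definition maximal_central (S : rightLoopType) (z : set (S * S)) : Prop :=
  central z /\ forall b, central b -> z `<=` b -> b = z.

(* The default value set0 is never used, by maximal_central_exists_unique. *)
Definition center_congruence (S : rightLoopType) : set (S * S) :=
  xget set0 [set z | maximal_central z].
Arguments center_congruence S : clear implicits.

Definition loop_center (S : rightLoopType) : set S :=
  eq_class (center_congruence S) 1%L.
Arguments loop_center S : clear implicits.

Section MaximalCentral.
Variable S : rightLoopType.
Local Open Scope rloop_scope.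

Let rldiv_eq (a b x : S) : x ∘ a = b -> b / a = x.
Proof. by move=> /rldivP ->. Qed.

Let Z : set S := [set z : S | forall x w : S,
  [/\ z ∘ x = x ∘ z, (x ∘ z) ∘ w = (x ∘ w) ∘ z & w ∘ (x ∘ z) = (w ∘ x) ∘ z]].
Let zeta : set (S * S) := [set p | exists2 z, Z z & p.2 = p.1 ∘ z].
Let cent : set ((S * S) * (S * S)) :=
  [set q | exists z, [/\ Z z, q.1.2 = q.1.1 ∘ z & q.2.2 = q.2.1 ∘ z]].

Let rlmulI (a : S) : injective (rlmul^~ a).
Proof. by move=> x y e; rewrite -(rlmulK a x) e rlmulK. Qed.

Let ZC z x : Z z -> z ∘ x = x ∘ z. Proof. by move=> /(_ x x)[]. Qed.
Let ZAC z x w : Z z -> (x ∘ z) ∘ w = (x ∘ w) ∘ z.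
Proof. by move=> /(_ x w)[]. Qed.
Let ZA z w x : Z z -> w ∘ (x ∘ z) = (w ∘ x) ∘ z.
Proof. by move=> /(_ x w)[]. Qed.

Let Z1 : Z 1. Proof. by move=> x w; rewrite !(rlmul1l, rlmul1r). Qed.

Let ZM a b : Z a -> Z b -> Z (a ∘ b).
Proof.
move=> Za Zb x w.
split.
- by rewrite (ZAC _ _ Zb) (ZC _ Za) -(ZA _ _ Zb).
- by rewrite !(ZA _ _ Zb) (ZAC _ _ Zb) (ZAC _ _ Za).
- by rewrite !(ZA _ _ Zb) (ZA _ _ Za).
Qed.

Let ZMM x y a b : Z a -> Z b -> (x ∘ a) ∘ (y ∘ b) = (x ∘ y) ∘ (a ∘ b).
Proof. by move=> Za Zb; rewrite !ZA // (ZAC _ _ Za). Qed.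

Let ZV a : Z a -> Z (1 / a).
Proof.
move=> Za x w.
have aV : 1 / a ∘ a = 1 by rewrite rldivK.
have key u : (u ∘ (1 / a)) ∘ a = u.
  by rewrite -ZA // aV rlmul1r.
split; apply: (@rlmulI a); rewrite ?key.
- by rewrite -(ZAC _ _ Za) aV rlmul1l.
- by rewrite -(ZAC _ _ Za) key.
- by rewrite -ZA // key.
Qed.

Let ZD a b : Z a -> Z b -> Z (a / b).
Proof.
move=> Za Zb; suff -> : a / b = a ∘ (1 / b) by apply: ZM => //; apply: ZV.
by apply: rldiv_eq; rewrite -ZA // rldivK rlmul1r.
Qed.

Let ZDD x y a b : Z a -> Z b -> (x ∘ a) / (y ∘ b) = (x / y) ∘ (a / b).
Proof.
move=> Za Zb; apply: rldiv_eq.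
by rewrite ZMM ?rldivK //; apply: ZD.
Qed.

Let zeta_congr : congruence zeta.
Proof.
split.
- by [].
- by move=> x _; exists 1; rewrite //= rlmul1r.
- move=> x y [z Zz /= ->]; exists (1 / z); first exact: ZV.
  by rewrite /= (ZAC _ _ Zz) -ZA // rldivK rlmul1r.
- move=> x y w [z Zz /= ->] [t Zt /= ->].
  by exists (z ∘ t); [apply: ZM | rewrite /= ZA].
- move=> x y u v [z Zz /= ->] [t Zt /= ->].
  by exists (z ∘ t); [apply: ZM | rewrite /= ZMM].
- move=> x y u v [z Zz /= ->] [t Zt /= ->].
  by exists (z / t); [apply: ZD | rewrite /= ZDD].
Qed.

Let ZI x a b : Z a -> Z b -> x ∘ a = x ∘ b -> a = b.
Proof. by move=> Za Zb; rewrite -(ZC x Za) -(ZC x Zb); apply: rlmulI. Qed.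

Let zeta_central : central zeta.
Proof.
split; first exact: zeta_congr.
exists cent; split => //.
- split.
  + by move=> [[x y] [u v]] [z [/= Zz -> ->]]; split; exists z.
  + by move=> [x y] [z Zz /= ->]; exists z.
  + by move=> [x y] [u v] [z [/= Zz -> ->]]; exists z.
  + move=> [x y] [u v] [w t] [z [/= Zz -> ->]] [z' [/= Zz' /(ZI Zz Zz') <- ->]].
    by exists z.
  + move=> [x y] [u v] [x' y'] [u' v'] [z [/= Zz -> ->]] [t [/= Zt -> ->]].
    by exists (z ∘ t); split => /=; [apply: ZM | rewrite ZMM | rewrite ZMM].
  + move=> [x y] [u v] [x' y'] [u' v'] [z [/= Zz -> ->]] [t [/= Zt -> ->]].
    by exists (z / t); split => /=; [apply: ZD | rewrite ZDD | rewrite ZDD].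
- move=> x y [z Zz /= ->]; split => //.
  + move=> [u v] [u' v'] /set_mem[t [/= Zt /(ZI Zz Zt) <- ->]].
    by move=> /set_mem[t' [/= Zt' /(ZI Zz Zt') <- ->]] ->.
  + by move=> u _; exists (u, u ∘ z) => //; exists z.
- by move=> x y _; exists 1; split => //=; rewrite rlmul1r.
- move=> x y u v [z [/= Zz -> ->]]; exists (1 / z).
  by split => /=; [apply: ZV | rewrite (ZAC _ _ Zz) -ZA // rldivK rlmul1r..].
- move=> x y z u v w [s [/= Zs -> ->]] [t [/= Zt -> ->]].
  by exists (s ∘ t); split => /=; [apply: ZM | rewrite ZA..].
Qed.

Let central_sub_zeta b : central b -> b `<=` zeta.
Proof.
move=> [_ [c [cC _ c_bij c_diag _ _]]] [x y] bxy.
have [_ _ /(_ 1 I) [[e z] /= cxy e1]] := c_bij x y bxy.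
rewrite {}e1 {e} in cxy.
have c1z := congr_sym cC cxy.
have [_ c1z1z] := congr_sub cC cxy.
have [_ inj _] := c_bij 1 z c1z1z.
have uniq u v w : c ((1, z), (u, v)) -> c ((1, z), (u, w)) -> v = w.
  by move=> /mem_set cv /mem_set cw; have [] := inj (u, v) (u, w) cv cw erefl.
have mulr u v w : c ((1, z), (u, v)) -> c ((1, z), (u ∘ w, v ∘ w)).
  move=> cuv; have := congr_mul cC cuv (c_diag 1 w I).
  by rewrite {1}/rlmul /= /prod_rlmul /= !rlmul1r.
have mull u v w : c ((1, z), (u, v)) -> c ((1, z), (w ∘ u, w ∘ v)).
  move=> cuv; have := congr_mul cC (c_diag 1 w I) cuv.
  by rewrite {1}/rlmul /= /prod_rlmul /= !rlmul1l.
have czz := congr_refl cC c1z1z.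
have cr w : c ((1, z), (w, w ∘ z)) by have := mull _ _ w czz; rewrite rlmul1r.
have cl w : c ((1, z), (w, z ∘ w)) by have := mulr _ _ w czz; rewrite rlmul1l.
exists z; last exact: uniq c1z (cr x).
move=> u w; split.
- exact: uniq (cl u) (cr u).
- exact: uniq (mulr _ _ w (cr u)) (cr (u ∘ w)).
- exact: uniq (mull _ _ w (cr u)) (cr (w ∘ u)).
Qed.

Lemma maximal_central_exists_unique :
  exists! z : set (S * S), maximal_central z.
Proof.
exists zeta; split.
  split=> [|b bC zb]; first exact: zeta_central.
  by apply/seteqP; split => //; apply: central_sub_zeta.
by move=> z [zC zM]; apply: zM; [exact: zeta_central | exact: central_sub_zeta].
Qed.

Lemma center_congruenceP : maximal_central (center_congruence S).
Proof.
have [z [zM _]] := maximal_central_exists_unique.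
exact: (xgetPex set0 (ex_intro _ z zM)).
Qed.

Lemma central_sub_center (b : set (S * S)) :
  central b -> b `<=` center_congruence S.
Proof.
have [z [_ zU]] := maximal_central_exists_unique.
rewrite -(zU _ center_congruenceP) (zU zeta); first exact: central_sub_zeta.
split=> [|d dC zd]; first exact: zeta_central.
by apply/seteqP; split => //; apply: central_sub_zeta.
Qed.
End MaximalCentral.

(* Main.v *)
(** The centre of [S] consists of the [z] such that [R_z] commutes with every
    [R_w] and [w (x z) = (w x) z]; conversely a congruence all of whose elements
    related to [1] have these properties is central.  As [G_S] is the stabilizer
    of [1] and [g] conjugates it to the stabilizer of [g 1], an element [g]
    normalizes [G_S] exactly when [g 1] is in the stability class of [1]; then
    [g = h R_u] with [u = g 1] and [h] in [G_S]. *)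
Require Import Defs.
From mathcomp Require Import all_boot.
From mathcomp Require Import boolp classical_sets functions.

Local Open Scope classical_set_scope.
Local Open Scope rloop_scope.

(** * Subgroups generated by a set *)

Section Generated.
Variables (G : groupType) (A : set G).
Local Open Scope group_scope.

Lemma sub_generated : A `<=` generated A.
Proof. exact: sub_smallest. Qed.

Lemma generated_min (B : set G) : subgroup B -> A `<=` B -> generated A `<=` B.
Proof. exact: smallest_sub. Qed.

Lemma generated_subgroup : subgroup (generated A).
Proof.
split.
- by move=> B [[]].
- move=> x y xA yA B AB; have [[_ BM _] _] := AB.
  by apply: BM; [apply: xA | apply: yA].
- by move=> x xA B AB; have [[_ _ BV] _] := AB; apply: BV; apply: xA.
Qed.

(** The elements commuting with [z] form a subgroup. *)
Lemma centralizer_generated (z : G) :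
  (forall g, A g -> z * g = g * z) -> forall g, generated A g -> z * g = g * z.
Proof.
move=> zA; apply: generated_min => //; split=> /= [|x y zx zy|x zx].
- by rewrite mulg1 mul1g.
- by rewrite mulgA zx -mulgA zy mulgA.
- by apply: (mulgI x); rewrite mulgA -zx -mulgA mulgV mulg1 mulgA mulgV mul1g.
Qed.
End Generated.

(** * Central elements and central congruences *)

Section CentralElements.
Variable S : rightLoopType.
Implicit Types (x y u v w z : S) (b : set (S * S)).

(** Commutation of [z] with every [w] is the case [x = 1] of the first equation. *)
Definition central_elt : set S := [set z | forall x w,
  (x ∘ z) ∘ w = (x ∘ w) ∘ z /\ w ∘ (x ∘ z) = (w ∘ x) ∘ z].

Lemma rldivE x y z : x ∘ y = z -> z / y = x.
Proof. by move=> <-; apply: rlmulK. Qed.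

Lemma rldivxx x : x / x = 1.
Proof. by apply: rldivE; rewrite rlmul1l. Qed.

Lemma central_eltAC z x w : central_elt z -> (x ∘ z) ∘ w = (x ∘ w) ∘ z.
Proof. by move=> /(_ x w)[]. Qed.

Lemma central_eltA z x w : central_elt z -> w ∘ (x ∘ z) = (w ∘ x) ∘ z.
Proof. by move=> /(_ x w)[]. Qed.

Lemma central_eltC z x : central_elt z -> z ∘ x = x ∘ z.
Proof. by move=> /(central_eltAC z 1 x); rewrite !rlmul1l. Qed.

Lemma central_elt_mulMM x y u v : central_elt u -> central_elt v ->
  (x ∘ u) ∘ (y ∘ v) = (x ∘ y) ∘ (u ∘ v).
Proof.
by move=> Zu Zv; rewrite !(central_eltA v) // (central_eltAC u).
Qed.

Lemma central_elt_divMM x y u v :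
  central_elt u -> central_elt v -> central_elt (u / v) ->
  (x ∘ u) / (y ∘ v) = (x / y) ∘ (u / v).
Proof.
by move=> Zu Zv Zuv; apply: rldivE; rewrite central_elt_mulMM // !rldivK.
Qed.

(** By (ii), the [c]-class of [(1, z)] has only one pair over each first coordinate. Multiplying its
    pairs by diagonal pairs, on either side, stays in the class, so each identity compares two pairs
    with the same first coordinate. *)
Lemma central_sub_elt b : central b -> eq_class b 1 `<=` central_elt.
Proof.
move=> [_ [c [cC _ c_bij c_diag _ _]]] z /= b1z.
have [_ inj _] := c_bij 1 z b1z.
have uniq u v w : c ((1, z), (u, v)) -> c ((1, z), (u, w)) -> v = w.
  by move=> /mem_set cv /mem_set cw; have [] := inj (u, v) (u, w) cv cw erefl.
have mulr u v w : c ((1, z), (u, v)) -> c ((1, z), (u ∘ w, v ∘ w)).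
  move=> cuv; have := congr_mul cC cuv (c_diag 1 w I).
  by rewrite {1}/rlmul /= /prod_rlmul /= !rlmul1r.
have mull u v w : c ((1, z), (u, v)) -> c ((1, z), (w ∘ u, w ∘ v)).
  move=> cuv; have := congr_mul cC (c_diag 1 w I) cuv.
  by rewrite {1}/rlmul /= /prod_rlmul /= !rlmul1l.
have cr w : c ((1, z), (w, w ∘ z)).
  by have := mull _ _ w (congr_refl cC b1z); rewrite rlmul1r.
move=> x w; split.
- exact: uniq (mulr _ _ w (cr x)) (cr (x ∘ w)).
- exact: uniq (mull _ _ w (cr x)) (cr (w ∘ x)).
Qed.

Lemma central_of_elts b :
  congruence b -> eq_class b 1 `<=` central_elt -> central b.
Proof.
move=> bC bZ; split=> //.
have b1M u v : b (1, u) -> b (1, v) -> b (1, u ∘ v).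
  by move=> bu bv; have := congr_mul bC bu bv; rewrite rlmul1l.
have b1D u v : b (1, u) -> b (1, v) -> b (1, u / v).
  by move=> bu bv; have := congr_div bC bu bv; rewrite rldivxx.
have b11 : b (1, 1) by apply: (congr_refl bC).
have b1d x y : b (x, y) -> b (1, y / x).
  move=> bxy; rewrite -(rldivxx x); apply: (congr_div bC) => //.
  exact: (congr_refl bC).
have Zd x y : b (x, y) -> central_elt (y / x) by move=> /b1d/bZ.
have Z1d x y : b (x, y) -> y = x ∘ (y / x).
  by move=> /Zd Zyx; rewrite -central_eltC // rldivK.
have Z1 : central_elt 1 by move=> x w; rewrite !rlmul1r.
(* Divide [x ∘ 1] by [x ∘ (y / x)] factor by factor. This serves condition (iv). *)
have ZV x y : b (x, y) -> x / y = 1 / (y / x).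
  move=> bxy; have /bZ ZV1 : b (1, 1 / (y / x)) by apply: b1D => //; apply: b1d.
  rewrite {1}(Z1d x y bxy) -{1}[x]rlmul1r central_elt_divMM ?rldivxx ?rlmul1l //.
  exact: Zd.
(* Since [y = x (y / x)] with [y / x] central, the quotient [y / x] is
   compatible with the operations, and comparing it gives a centering. *)
exists [set p | [/\ b p.1, b p.2 & p.1.2 / p.1.1 = p.2.2 / p.2.1]]; split.
- split.
  + by move=> [p q] [].
  + by move=> p bp.
  + by move=> p q [].
  + by move=> p q r [/= bp bq ->] [/= _ br ->].
  + move=> [x y] [u v] [x' y'] [u' v'] [/= bxy buv e] [/= bxy' buv' e'].
    have quot s t s' t' : b (s, t) -> b (s', t') ->
        (t ∘ t') / (s ∘ s') = (t / s) ∘ (t' / s').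
      move=> bst bst'; apply: rldivE.
      rewrite central_eltC; last first.
        by apply: bZ; apply: b1M; apply: b1d.
      by rewrite -central_elt_mulMM -?Z1d //; apply: Zd.
    split; [exact: (congr_mul bC)|exact: (congr_mul bC)|].
    by rewrite [LHS]quot // [RHS]quot // e e'.
  + move=> [x y] [u v] [x' y'] [u' v'] [/= bxy buv e] [/= bxy' buv' e'].
    have quot s t s' t' : b (s, t) -> b (s', t') ->
        (t / t') / (s / s') = (t / s) / (t' / s').
      move=> bst bst'.
      have Zq : central_elt (t / s / (t' / s')).
        by apply: bZ; apply: b1D; apply: b1d.
      apply: rldivE; rewrite central_eltC //.
      by rewrite -central_elt_divMM -?Z1d //; apply: Zd.
    split; [exact: (congr_div bC)|exact: (congr_div bC)|].
    by rewrite [LHS]quot // [RHS]quot // e e'.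
- by [].
- move=> x y bxy; split=> //.
  + move=> [u v] [u' v'] /set_mem[/= _ _ e] /set_mem[/= _ _ e'] eu.
    rewrite -{}eu in e' *.
    (* A pair is determined by its first coordinate and its quotient. *)
    by rewrite -[v](rldivK u) -[v'](rldivK u) -e -e'.
  + move=> u _; exists (u, y / x ∘ u) => //; split=> //=; last by rewrite rlmulK.
    have := congr_mul bC (b1d _ _ bxy) (congr_refl bC (x := u) I).
    by rewrite rlmul1l.
- by move=> x y _; split; rewrite /= ?rldivxx //; apply: (congr_refl bC).
- move=> x y u v [/= bxy buv e].
  by split; rewrite /= ?(ZV _ _ bxy) ?(ZV _ _ buv) ?e //; apply: (congr_sym bC).
- move=> x y z u v w [/= bxy buv e] [/= byz bvw e'].
  (* Quotients compose along a chain, which gives condition (v). *)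
  have quot r s t : b (r, s) -> b (s, t) -> t / r = (t / s) ∘ (s / r).
    move=> brs bst; apply: rldivE.
    by rewrite central_eltAC -?central_eltA -?Z1d ?rldivK //; apply: Zd.
  split=> /=; [exact: congr_trans bC _ _ _ bxy byz| |].
    exact: congr_trans bC _ _ _ buv bvw.
  by rewrite (quot x y) // (quot u v) // e e'.
Qed.
End CentralElements.
Arguments central_elt S : clear implicits.

(** * The group torsion as the stabilizer of the identity *)

Section GroupTorsion.
Variable S : rightLoopType.
Local Open Scope group_scope.

Lemma rtrans1 : rtrans S 1%L = 1.
Proof. by apply: symP => x; apply: rlmul1r. Qed.

Lemma rmul_group_rtrans (x : S) : rmul_group S (rtrans S x).
Proof. by apply: sub_generated; exists x. Qed.

Lemma group_torsion_gen (y z : S) :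
  group_torsion S (rtrans S y * rtrans S z * (rtrans S (y ∘ z)%L)^-1).
Proof. by apply: sub_generated; exists y, z. Qed.

(** The products [h R_u] are stable under right multiplication by each [R_v], since
    [R_u R_v = (R_u R_v R_{u∘v}^-1) R_{u∘v}], and by each [R_v^-1]. *)
Lemma group_torsion_rtrans_mul (g : sym S) : rmul_group S g ->
  exists h u, group_torsion S h /\ g = h * rtrans S u.
Proof.
have [T1 TM TV] :
  subgroup (group_torsion S) := generated_subgroup _ _.
pose stable (f : sym S) := forall h u, group_torsion S h ->
  exists h' u', group_torsion S h' /\ h * rtrans S u * f = h' * rtrans S u'.
(* Pairing [f] with [f^-1] makes closure under inverses immediate. *)
suff key : rmul_group S `<=` [set f | stable f /\ stable f^-1].
  move=> /key[/(_ _ 1%L T1)[h [u [Th e]]] _]; exists h, u; split=> //.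
  by rewrite -e rtrans1 !mul1g.
have stableM f k : stable f -> stable k -> stable (f * k).
  move=> sf sk h u /sf-/(_ u)[h1 [u1 [T1h e1]]].
  have [h2 [u2 [T2h e2]]] := sk h1 u1 T1h.
  by exists h2, u2; rewrite mulgA e1.
have stable1 : stable 1 by move=> h u Th; exists h, u; rewrite mulg1.
apply: generated_min.
  split=> /= [|f k [sf sf'] [sk sk']|f [sf sf']]; first by rewrite invg1.
  - by rewrite invgM; split; apply: stableM.
  - by rewrite invgK.
move=> _ [v _ <-]; split=> h u Th.
- exists (h * (rtrans S u * rtrans S v * (rtrans S (u ∘ v)%L)^-1)), (u ∘ v)%L.
  split; first by apply: TM => //; apply: group_torsion_gen.
  by rewrite !mulgA mulgVK.
(* As [w ∘ v = u], the generator at [(w, v)] is [R_w R_v R_u^-1], and its inverse times [R_w] is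
   [R_u R_v^-1]. *)
- pose w := (u / v)%L.
  exists (h * (rtrans S w * rtrans S v * (rtrans S u)^-1)^-1), w.
  split; last by rewrite !invgM invgK !mulgA mulgVK.
  apply: TM => //; apply: TV; have := group_torsion_gen w v.
  by rewrite /w rldivK.
Qed.

Lemma stab_subgroup (G : set (sym S)) (x : S) :
  subgroup G -> subgroup (stab G x).
Proof.
move=> [G1 GM GV]; split=> [|f k [Gf fx] [Gk kx]|f [Gf fx]]; first by split.
- by split; [apply: GM | rewrite /= fx].
- by split; [apply: GV | rewrite -{1}fx /= symK].
Qed.

Lemma stab_conj (G : set (sym S)) (g : sym S) (x : S) :
  subgroup G -> G g -> [set k ^ g | k in stab G x] = stab G (g x).
Proof.
move=> [_ GM GV] Gg; apply/seteqP; split.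
- move=> _ [k [Gk kx] <-]; split; last by rewrite /= symK kx.
  by apply: (GM); [apply: GV | apply: GM].
- move=> k [Gk kx]; exists (k ^ g^-1); last by rewrite conjgKV.
  split; last by rewrite /= kx symK.
  by apply: (GM); [apply: (GV); apply: (GV) | apply: GM => //; apply: GV].
Qed.

(** Each generator moves [1] to [y], then to [y ∘ z], then back to [1]. Conversely, [h R_u] sends
    [1] to [u], so fixing [1] forces [u = 1]. *)
Lemma group_torsionE : group_torsion S = stab (rmul_group S) 1%L.
Proof.
have [_ GM GV] : subgroup (rmul_group S) := generated_subgroup _ _.
have sub_stab : group_torsion S `<=` stab (rmul_group S) 1%L.
  apply: generated_min; first exact/stab_subgroup/generated_subgroup.
  move=> _ [y [z ->]]; split; last by rewrite /= rlmul1l rldivxx.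
  by apply: (GM); [apply: (GM)|apply: (GV)]; exact: rmul_group_rtrans.
apply/seteqP; split=> // g [Gg g1].
have [h [u [Th e]]] := group_torsion_rtrans_mul g Gg.
have [_ h1] := sub_stab h Th.
have u1 : u = 1%L by rewrite -g1 e /= h1 rlmul1l.
by rewrite e u1 rtrans1 mulg1.
Qed.
End GroupTorsion.

(** It suffices to commute with the generators [R_w], and this is the first equation of
    [central_elt]. *)
Lemma central_elt_rtrans (S : rightLoopType) (z : S) :
  central_elt S z -> centerg (rmul_group S) (rtrans S z).
Proof.
move=> Zz; split; first exact: rmul_group_rtrans.
apply: centralizer_generated => _ [w _ <-].
by apply: symP => x; apply: central_eltAC.
Qed.

Theorem theorem3p9 (S : rightLoopType) (hsigma : congruence (stability S)) :
  let sigma1 : set S := eq_class (stability S) 1 in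
  let GS : set (sym S) := group_torsion S in
  let GSS : set (sym S) := rmul_group S in
  (rtrans S @` sigma1 = centerg GSS ->
   (forall u v w : S, sigma1 u -> (v ∘ u) ∘ w = v ∘ (u ∘ w)) ->
   sigma1 = loop_center S)
  /\
  (sigma1 = loop_center S ->
   rtrans S @` sigma1 `<=` centerg GSS /\
   normalizer_in GSS GS = mul_set GS (centerg GSS)).
Proof.
move=> sigma1 GS GSS.
have center_elt : loop_center S `<=` central_elt S.
  by apply: central_sub_elt; have [] := center_congruenceP S.
split=> [sigma1E assoc|sigma1E].
  apply/seteqP; split=> z; last first.
    (* Centrality of [R_z] gives [R_z = R_u] with [u] in [sigma1]; evaluation at [1] yields
       [u = z]. *)
    move=> /center_elt/central_elt_rtrans; rewrite -sigma1E => -[u su e].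
    suff <- : u = z by [].
    by have := congr1 (fun f : sym S => f 1) e; rewrite /= !rlmul1l.
  apply: central_sub_center; apply: central_of_elts => // {}z sz.
  have AC x w : (x ∘ z) ∘ w = (x ∘ w) ∘ z.
    have [_ /(_ _ (rmul_group_rtrans S w))] : centerg GSS (rtrans S z).
      by rewrite -sigma1E; exists z.
    by move=> /(congr1 (fun f : sym S => f x)).
  move=> x w; split=> //.
  (* [(w ∘ x) ∘ z = (w ∘ z) ∘ x = w ∘ (z ∘ x) = w ∘ (x ∘ z)]. *)
  by have := AC 1 x; rewrite !rlmul1l -AC assoc // => ->.
have sigma1_center : rtrans S @` sigma1 `<=` centerg GSS.
  by move=> _ [z sz <-]; apply/central_elt_rtrans/center_elt; rewrite -sigma1E.
split=> //.
have G_subgroup : subgroup GSS := generated_subgroup _ _.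
apply/seteqP; split=> g.
  (* Normalizing now reads as equality of the stabilizers of [g 1] and [1], that is, [g 1] lies in
     [sigma1]. *)
  move=> [Gg]; rewrite /GS group_torsionE stab_conj // => sg1.
  have [h [u [Th e]]] := group_torsion_rtrans_mul S g Gg.
  have g1 : g 1 = u.
    move: Th; rewrite group_torsionE => -[_ h1].
    by rewrite e /= h1 rlmul1l.
  exists h; first by rewrite -group_torsionE.
  exists (rtrans S u) => //.
  by apply: sigma1_center; exists u => //; rewrite -g1; apply/esym.
move=> [h Th [z [Gz zC] <-]].
have [_ GM _] := G_subgroup.
move: Th; rewrite /GS group_torsionE => -[Gh h1].
have Ghz : GSS (h * z)%g by apply: GM.
(* Since [h] fixes [1], only conjugation by the central element [z] remains. *)
split=> //; rewrite stab_conj //= h1 -stab_conj //.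
have conj_id k : GSS k -> (k ^ z)%g = k.
  by move=> /zC zk; rewrite conjgE -zk mulKg.
apply/seteqP; split=> [_ [k Gk <-]|k Gk]; first by rewrite conj_id //; case: Gk.
by exists k => //; rewrite conj_id //; case: Gk.
Qed.
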